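(* For every real $p > 3$ there exists a constant $C_p > 0$, depending only on $p$, such that the following holds. For every integer $n \ge 1$ and all real numbers $a_1 \ge \ldots \ge a_n \ge 0$ with $\sum_{i=1}^n a_i^2 = 1$, if $\varepsilon_1, \ldots, \varepsilon_n$ are i.i.d. Rademacher random variables, $S = \sum_{i=1}^n a_i \varepsilon_i$ and $S_n = \frac{1}{\sqrt n} \sum_{i=1}^n \varepsilon_i$, then $$\mathbb{E}|S|^p \le \mathbb{E}|S_n|^p - C_p \sum_{i=1}^n \left(a_i^2 - \frac1n\right)^2 .$$
   Context: A Rademacher random variable $\varepsilon$ satisfies $\mathbb{P}(\varepsilon = 1) = \mathbb{P}(\varepsilon = -1) = \frac12$. *)

(* Defs.v *)
From HB Require Import structures.
From mathcomp Require Import all_boot all_order all_algebra.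
From mathcomp Require Import all_classical all_reals all_analysis.

Set Implicit Arguments.
Unset Strict Implicit.
Unset Printing Implicit Defensive.

Import Order.TTheory GRing.Theory Num.Theory.
Import numFieldNormedType.Exports.

Local Open Scope classical_set_scope.
Local Open Scope ring_scope.

Definition rademacher (R : realType) (d : measure_display)
    (T : measurableType d) (P : probability T R) (X : {RV P >-> R}) : Prop :=
  P (X @^-1` [set 1]) = (2^-1)%:E /\ P (X @^-1` [set (-1)]) = (2^-1)%:E.

(* Mutual (not merely pairwise) independence: the product rule holds for every
   subfamily J. *)
Definition mutually_independent (R : realType) (d : measure_display)
    (T : measurableType d) (P : probability T R) (I : finType)
    (X : I -> {RV P >-> R}) : Prop :=
  forall (J : {set I}) (B : I -> set R), (forall i, measurable (B i)) ->
    P (\bigcap_(i in [set` J]) (X i @^-1` B i)) =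
    (\prod_(i in J) P (X i @^-1` B i))%E.

(* Main.v *)
Require Import Defs.
From HB Require Import structures.
From mathcomp Require Import all_boot all_order all_algebra.
From mathcomp Require Import all_classical all_reals all_analysis.
From mathcomp Require Import measurable_realfun ring lra.

(* Moving squared weights a_i^2 and a_j^2 towards each other keeps their sum and
   increases (a_i a_j)^2.  If the third derivative of f is nondecreasing, such a
   transfer increases E f(S): conditionally on the sum Y of the other terms, put
   G(u) = f(Y + u) + f(Y - u); then G'(u)/u is nondecreasing, i.e. G is a
   convex function of u^2, and the conditional mean of f(S) is
   (G(a_i + a_j) + G(a_i - a_j))/4.  For p > 3 this applies to
   f(x) = |x|^p - c phi(x) with phi(x) = x^6 - x^4 - x^8/400 and c small,
   because the fourth derivative of phi is negative both near 0 and at infinity.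
   A moment computation (E Y^2 = 1 - a_i^2 - a_j^2 and E Y^4 <= 3) shows that
   E phi(S) grows at least proportionally to the decrease of sum a_k^4, hence so
   does E|S|^p.  Finitely many transfers, each making one more squared weight
   equal to 1/n, lead to the equal weights, and
   sum (a_k^2 - 1/n)^2 = sum a_k^4 - 1/n. *)

Set Implicit Arguments.
Unset Strict Implicit.
Unset Printing Implicit Defensive.

Import Order.TTheory GRing.Theory Num.Theory.
Import numFieldNormedType.Exports.

Local Open Scope classical_set_scope.
Local Open Scope ring_scope.

(** * Calculus on the line: monotonicity from the sign of a derivative *)

Lemma is_derive_ge0_le (R : realType) (f f' : R -> R) (a b : R) :
  a <= b -> (forall x, a <= x <= b -> is_derive x 1 f (f' x)) ->
  (forall x, a <= x <= b -> 0 <= f' x) -> f a <= f b.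
Proof.
move=> ab df f'0.
have [||c cab fE] := @MVT_segment R f f' a b ab.
- by move=> x; rewrite in_itv/= => /andP[ax xb]; apply: df; rewrite !ltW.
- apply: continuous_in_subspaceT => x; rewrite inE/= in_itv/= => axb.
  by have [? _] := df x axb; apply/differentiable_continuous/derivable1_diffP.
by rewrite -subr_ge0 fE mulr_ge0 ?subr_ge0// f'0.
Qed.

Lemma is_derive_fcomp_add (R : realType) (f f' : R -> R) (y x : R) :
  (forall z : R, is_derive z 1 f (f' z)) ->
  is_derive x 1 (fun u => f (y + u)) (f' (y + x)).
Proof.
move=> df; have h : is_derive x 1 (fun u => y + u) (1 : R).
  rewrite -[X in is_derive _ _ _ X]add0r.
  exact: (is_deriveD (is_derive_cst y x 1) (is_derive_id x 1)).
by apply: is_derive_eq (is_derive1_comp (df _) h) _; rewrite mulr1.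
Qed.

Lemma is_derive_fcomp_sub (R : realType) (f f' : R -> R) (y x : R) :
  (forall z : R, is_derive z 1 f (f' z)) ->
  is_derive x 1 (fun u => f (y - u)) (- f' (y - x)).
Proof.
move=> df; have h : is_derive x 1 (fun u => y - u) (-1 : R).
  rewrite -[X in is_derive _ _ _ X]add0r.
  exact: (is_deriveB (is_derive_cst y x 1) (is_derive_id x 1)).
by apply: is_derive_eq (is_derive1_comp (df _) h) _; rewrite mulrN1.
Qed.

(** * Derivatives of absolute powers and of signed powers *)

(** The odd power function: up to constant factors, the successive derivatives of [|x|^p] alternate
    between [spow] and absolute powers. *)
Definition spow (R : realType) (q x : R) : R := Num.sg x * `|x| `^ q.

Lemma abspow_mul (R : realType) (q x : R) : 0 < q ->
  `|x| `^ (q + 1) = x * spow q x.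
Proof.
move=> q0; have [->|x0] := eqVneq x 0.
  by rewrite normr0 mul0r powR0// gt_eqF// addr_gt0.
rewrite /spow mulrA (mulrC x) -normrEsg -[LHS]mulr_powRB1 ?addr_gt0//.
by rewrite addrK.
Qed.

Lemma spow_mul (R : realType) (q x : R) : 0 < q ->
  spow (q + 1) x = x * `|x| `^ q.
Proof.
by move=> q0; rewrite /spow -mulr_powRB1 ?addr_gt0// addrK mulrA -numEsg.
Qed.

Lemma spowN (R : realType) (q x : R) : spow q (- x) = - spow q x.
Proof. by rewrite /spow sgrN normrN mulNr. Qed.

Lemma spow0 (R : realType) (q : R) : spow q 0 = 0.
Proof. by rewrite /spow sgr0 mul0r. Qed.

Lemma spow_pos (R : realType) (q x : R) : 0 < x -> spow q x = x `^ q.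
Proof. by move=> x0; rewrite /spow gtr0_sg// gtr0_norm// mul1r. Qed.

Lemma abspow_cvg0 (R : realType) (q : R) : 0 < q ->
  `|x| `^ q @[x --> (0 : R)] --> (0 : R).
Proof.
move=> q0; apply/cvgrPdist_lt => e e0; near=> x.
rewrite sub0r normrN ger0_norm ?powR_ge0//.
have -> : e = (e `^ q^-1) `^ q by rewrite -powRrM mulVf ?gt_eqF// powRr1// ltW.
rewrite gt0_ltr_powR// ?nnegrE ?powR_ge0//.
near: x; have : 0 < e `^ q^-1 by exact: powR_gt0.
exact: (@nbhs0_lt R R^o).
Unshelve. all: by end_near. Qed.

Lemma spow_cvg0 (R : realType) (q : R) : 0 < q ->
  spow q x @[x --> (0 : R)] --> (0 : R).
Proof.
move=> q0; have := abspow_cvg0 q0 => /cvgrPdist_lt h.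
apply/cvgrPdist_lt => e e0; near=> x.
have : `|0 - `|x| `^ q| < e by near: x; exact: h.
rewrite !sub0r !normrN; apply: le_lt_trans.
by rewrite /spow normrM ler_piMl// normr_sg; case: eqP.
Unshelve. all: by end_near. Qed.

Lemma is_derive_abspow (R : realType) (q x : R) : 1 < q ->
  is_derive x 1 (fun z : R => `|z| `^ q) (q * spow (q - 1) x).
Proof.
move=> q1; have q10 : 0 < q - 1 by rewrite subr_gt0.
have pos (z : R) : 0 < z ->
    is_derive z 1 (fun z : R => `|z| `^ q) (q * spow (q - 1) z).
  move=> z0; apply: (@near_eq_is_derive R R^o R^o (fun z : R => z `^ q));
    [near=> b|].
  - by rewrite gtr0_norm//; near: b; exact: lt_nbhsr.
  - by rewrite spow_pos//; exact: is_derive1_powR.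
have [x0|x0|->] := ltgtP x 0; last 1 first.
(* At 0 the difference quotient of [|z|^q] is exactly [spow (q - 1) z], which tends to 0;
   Caratheodory's criterion then gives the derivative. Negative [x] reduces to positive [x] by
   parity. *)
- rewrite spow0 !mulr0.
  apply/is_derive1_caratheodory; exists (spow (q - 1)); split.
  + move=> z; rewrite subr0 normr0 powR0 ?subr0 ?gt_eqF ?(lt_trans _ q1)//.
    by rewrite -{1}(subrK 1 q) abspow_mul// mulrC.
  + by move: (spow_cvg0 q10); rewrite -[X in _ --> X](spow0 (q - 1)).
  + exact: spow0.
- have -> : q * spow (q - 1) x = q * spow (q - 1) (- x) * -1.
    by rewrite spowN mulrN1 mulrN opprK.
  have Nx0 : 0 < - x by rewrite oppr_gt0.
  rewrite (_ : (fun z => _) = (fun z : R => `|z| `^ q) \o -%R); last first.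
    by apply/funext => z /=; rewrite normrN.
  exact: is_derive1_comp (pos _ Nx0) (is_deriveNid _ _).
- exact: pos.
Unshelve. all: by end_near. Qed.

Lemma is_derive_spow (R : realType) (q x : R) : 1 < q ->
  is_derive x 1 (spow q) (q * `|x| `^ (q - 1)).
Proof.
move=> q1; have q10 : 0 < q - 1 by rewrite subr_gt0.
have pos (z : R) : 0 < z -> is_derive z 1 (spow q) (q * `|z| `^ (q - 1)).
  move=> z0; apply: (@near_eq_is_derive R R^o R^o (fun z : R => z `^ q));
    [near=> b|].
  - by rewrite spow_pos//; near: b; exact: lt_nbhsr.
  - by rewrite gtr0_norm//; exact: is_derive1_powR.
have [x0|x0|->] := ltgtP x 0; last 1 first.
- rewrite normr0 powR0 ?gt_eqF// mulr0.
  apply/is_derive1_caratheodory; exists (fun x => `|x| `^ (q - 1)); split.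
  + move=> z; rewrite subr0 spow0 subr0.
    by rewrite -{1}(subrK 1 q) spow_mul// mulrC.
  + rewrite /prop_for /continuous_at normr0 powR0 ?gt_eqF//.
    exact: abspow_cvg0.
  + by rewrite normr0 powR0 ?gt_eqF.
- have -> : q * `|x| `^ (q - 1) = - (q * `|- x| `^ (q - 1) * -1).
    by rewrite normrN mulrN1 opprK.
  have Nx0 : 0 < - x by rewrite oppr_gt0.
  rewrite (_ : spow q = - (spow q \o -%R)); last first.
    by apply/funext => z; rewrite fctE/= spowN opprK.
  exact/is_deriveN/(is_derive1_comp (pos _ Nx0) (is_deriveNid _ _)).
- exact: pos.
Unshelve. all: by end_near. Qed.

Lemma is_derive_monom (R : realType) (k : R) (n : nat) (x : R) :
  is_derive x 1 (fun z => k * z ^+ n) (k * (n%:R * x ^+ n.-1)).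
Proof.
have := is_deriveZ k (is_deriveX n (is_derive_id x (1 : R))).
rewrite /GRing.scale /= mulr1 (_ : k \*: _ = fun z => k * z ^+ n)//.
by apply/funext => z; rewrite -[LHS]/(k * (id ^+ n) z) exprfctE.
Qed.

(** * Comparison of two pairs of weights with the same sum of squares *)

(** The sum over the four sign choices of two terms, grouped by the even function [G] of the
    overview at [a + b] and [a - b]. *)
Definition sum_signs (R : realType) (f : R -> R) (y a b : R) : R :=
  f (y + (a + b)) + f (y - (a + b)) + (f (y + (a - b)) + f (y - (a - b))).

Lemma sum_signsC (R : realType) (f : R -> R) (y a b : R) :
  sum_signs f y a b = sum_signs f y b a.
Proof.
rewrite /sum_signs (addrC b a); congr (_ + _).
by rewrite addrC -[a - b]opprB opprK.
Qed.

Section sum_signs_le.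
Variables (R : realType) (f f1 f2 f3 : R -> R).
Hypothesis df : forall x : R, is_derive x 1 f (f1 x).
Hypothesis df1 : forall x : R, is_derive x 1 f1 (f2 x).
Hypothesis df2 : forall x : R, is_derive x 1 f2 (f3 x).
Hypothesis f3_ndecr : {homo f3 : x y / x <= y}.

Let G (y u : R) : R := f (y + u) + f (y - u).
Let G1 (y u : R) : R := f1 (y + u) - f1 (y - u).
Let G2 (y u : R) : R := f2 (y + u) + f2 (y - u).
Let G3 (y u : R) : R := f3 (y + u) - f3 (y - u).

Let dG y (u : R) : is_derive u 1 (G y) (G1 y u).
Proof.
exact: is_deriveD (is_derive_fcomp_add _ _ df) (is_derive_fcomp_sub _ _ df).
Qed.

Let dG1 y (u : R) : is_derive u 1 (G1 y) (G2 y u).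
Proof.
have := is_deriveB (is_derive_fcomp_add y u df1) (is_derive_fcomp_sub y u df1).
by rewrite opprK.
Qed.

Let dG2 y (u : R) : is_derive u 1 (G2 y) (G3 y u).
Proof.
exact: is_deriveD (is_derive_fcomp_add _ _ df2) (is_derive_fcomp_sub _ _ df2).
Qed.

(** The difference of the two sides vanishes at 0 and has derivative [u * G3 y u], which is
    nonnegative because [f3] is nondecreasing. *)
Let G1_le y (u : R) : 0 <= u -> G1 y u <= u * G2 y u.
Proof.
move=> u0; rewrite -subr_ge0.
have -> : 0 = 0 * G2 y 0 - G1 y 0 :> R.
  by rewrite /G1 addr0 subr0 subrr mul0r subrr.
apply: (@is_derive_ge0_le _ (fun u => u * G2 y u - G1 y u)
  (fun u => u * G3 y u)) => // x /andP[x0 _].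
- apply: is_derive_eq (is_deriveB (is_deriveM (is_derive_id x 1) (dG2 y x))
    (dG1 y x)) _.
  by rewrite /GRing.scale /= mulr1 addrK.
- by rewrite mulr_ge0// subr_ge0 f3_ndecr// lerD2l; lra.
Qed.

(** By [G1_le] the numerator in the quotient rule is nonnegative. This is the convexity of [G y] as
    a function of [u^2]. *)
Let G1_div_le y (u v : R) : 0 < u -> u <= v -> G1 y u / u <= G1 y v / v.
Proof.
move=> u0 uv.
apply: (@is_derive_ge0_le _ (fun x => G1 y x / x)
  (fun x => (x * G2 y x - G1 y x) / x ^+ 2)) => // x /andP[ux _].
- have x0 : x != 0 by rewrite gt_eqF// (lt_le_trans u0).
  have := is_deriveM (dG1 y x) (is_deriveV (f := id) x0 (is_derive_id x 1)).
  move=> h; apply: is_derive_eq h _.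
  by rewrite /GRing.scale /=; field.
- by rewrite divr_ge0 ?sqr_ge0// subr_ge0 G1_le// (le_trans _ ux)// ltW.
Qed.

(** The squares of [a + b] and [a - b] have the fixed sum [2 (a^2 + b^2)], and a larger product
    [a b] spreads them apart, which increases the sum of the values of a function convex in the
    square. *)
Lemma sum_signs_le (y a b a' b' : R) :
  0 <= a -> 0 <= b -> 0 <= a' -> 0 <= b' ->
  a ^+ 2 + b ^+ 2 = a' ^+ 2 + b' ^+ 2 -> a * b <= a' * b' ->
  sum_signs f y a b <= sum_signs f y a' b'.
Proof.
wlog : a b / b <= a => [th|ba].
  have [/th//|/ltW ab] := leP b a; rewrite (sum_signsC f y a b) mulrC.
  by move=> ? ? ? ? e; apply: th => //; rewrite addrC.
wlog : a' b' / b' <= a' => [th|ba'].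
  have [/th//|/ltW ab] := leP b' a'; rewrite (sum_signsC f y a' b') (mulrC a').
  by move=> ? ? ? ? e; apply: th => //; rewrite e addrC.
move=> a0 b0 a'0 b'0 e ab.
have [u0|] := ltP 0 (a + b); last first.
  move=> h; have -> : a = 0 by lra.
  have -> : b = 0 by lra.
  have -> : a' = 0 by nra.
  have -> : b' = 0 by nra.
  by [].
(* [D] is minimal at [a + b], and [(a + b)^2 + (a - b)^2] is unchanged. *)
pose m := G1 y (a + b) / (a + b).
pose D x := G y x - m / 2 * x ^+ 2.
pose D1 x := G1 y x - m * x.
have dD (x : R) : is_derive x 1 D (D1 x).
  have := is_deriveB (dG y x) (is_derive_monom (m / 2) 2 x).
  move=> h; apply: is_derive_eq h _.
  by rewrite /D1 /= expr1; field.
have D1_ge0 x : a + b <= x -> 0 <= D1 x.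
  move=> ux; have x0 : 0 < x by apply: lt_le_trans ux.
  by rewrite subr_ge0 -ler_pdivlMr// G1_div_le.
have D1_le0 x : 0 <= x <= a + b -> D1 x <= 0.
  rewrite le_eqVlt => /andP[/predU1P[<- _|x0 xu]].
    by rewrite /D1 /G1 addr0 subr0 subrr mulr0 subrr.
  by rewrite subr_le0 -ler_pdivrMr// G1_div_le.
have uu' : a + b <= a' + b' by nra.
have ll' : a' - b' <= a - b by nra.
have h1 : D (a + b) <= D (a' + b').
  apply: (is_derive_ge0_le uu' (fun x _ => dD x)) => x /andP[ux _].
  exact: D1_ge0.
have h2 : D (a - b) <= D (a' - b').
  rewrite -lerN2; apply: (@is_derive_ge0_le _ (fun x => - D x)
    (fun x => - D1 x) _ _ ll').
  move=> x /andP[lx xl]; rewrite oppr_ge0.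
  by apply: D1_le0; apply/andP; split; lra.
(* Adding [h1] and [h2], the quadratic corrections of [D] cancel, since both pairs have the same sum
   of squares. *)
rewrite /sum_signs -!/(G y _).
move: h1 h2; rewrite /D.
have -> : (a' + b') ^+ 2 = 2 * (a ^+ 2 + b ^+ 2) - (a' - b') ^+ 2.
  by rewrite e; ring.
have -> : (a + b) ^+ 2 = 2 * (a ^+ 2 + b ^+ 2) - (a - b) ^+ 2 by ring.
lra.
Qed.

End sum_signs_le.

(** * The test polynomial and the third derivative condition *)

Lemma powR_ge_on (R : realType) (M r x : R) : 1 <= M -> M^-1 <= x <= M ->
  (M `^ `|r|)^-1 <= x `^ r.
Proof.
move=> M1 /andP[Mx xM]; have M0 : 0 < M by apply: lt_le_trans M1.
have x0 : 0 < x by apply: lt_le_trans Mx; rewrite invr_gt0.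
have [r0|r0] := leP 0 r.
  rewrite ger0_norm// -powRN -mulN1r powRrM powR_inv1 ?(ltW M0)//.
  by apply: (ge0_ler_powR r0); rewrite ?nnegrE ?invr_ge0 ?(ltW x0) ?(ltW M0).
have -> : x `^ r = (x `^ (- r))^-1 by rewrite -powRN opprK.
rewrite ltr0_norm// lef_pV2 ?posrE ?powR_gt0//.
by apply: ge0_ler_powR; rewrite ?nnegrE ?oppr_ge0 ?(ltW r0) ?(ltW x0) ?(ltW M0).
Qed.

(** The polynomial is the fourth derivative of [testpoly]. It is nonpositive below 1/10 and above
    10; in between it is bounded, while [x^r] stays away from 0. The exponent may be negative: the
    case needed is [r = p - 4]. *)
Lemma powR_ge_poly (R : realType) (r : R) : exists2 c, 0 < c &
  forall x : R, 0 < x -> c * (360 * x ^+ 2 - 24 - 21 / 5 * x ^+ 4) <= x `^ r.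
Proof.
pose k : R := (10 `^ `|r|)^-1.
have k0 : 0 < k by rewrite invr_gt0 powR_gt0// ltr0n.
(* On [[1/10, 10]] the polynomial is at most [360 * 10^2], the inverse of [e]. *)
pose e : R := 360^-1 * 100^-1.
have e0 : 0 < e by rewrite mulr_gt0 ?invr_gt0 ?ltr0n.
have ke0 : 0 < k * e by exact: mulr_gt0.
exists (k * e) => // x x0.
have x4 : 0 <= x ^+ 4 by rewrite exprn_ge0// ltW.
have [x1|x1] := ltP x 10^-1.
  apply: le_trans (powR_ge0 _ _); rewrite (pmulr_rle0 _ ke0).
  have : x ^+ 2 <= 10^-1 * 10^-1 by rewrite expr2 ler_pM// ltW.
  lra.
have [x2|x2] := ltP 10 x.
  apply: le_trans (powR_ge0 _ _); rewrite (pmulr_rle0 _ ke0).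
  have h : 10 * 10 <= x ^+ 2 by rewrite expr2 ler_pM// ltW.
  have : 10 * 10 * x ^+ 2 <= x ^+ 4.
    by rewrite (exprM x 2 2) [leRHS]expr2 ler_wpM2r// sqr_ge0.
  lra.
apply: (@le_trans _ _ k); last first.
  by apply: powR_ge_on; rewrite ?x1// ler1n.
rewrite -[leLHS]mulrA (ger_pMr _ k0).
have : x ^+ 2 <= 10 * 10 by rewrite expr2 ler_pM// ltW.
rewrite /e; lra.
Qed.

(** Meant for a third derivative that need not be differentiable at 0 (when [p < 4]): monotonicity
    is proved on the positive axis and carried across 0 by oddness. *)
Lemma odd_homo_le (R : realType) (f : R -> R) :
  (forall x, f (- x) = - f x) ->
  (forall x, 0 <= x -> 0 <= f x) ->
  (forall x y, 0 < x -> x <= y -> f x <= f y) ->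
  {homo f : x y / x <= y}.
Proof.
move=> fN f0 fle x y xy.
have [x0|x0|x0] := ltgtP x 0; last 1 first.
- have /eqP := fN 0; rewrite oppr0 -addr_eq0 -mulr2n mulrn_eq0/= x0 => /eqP ->.
  by rewrite f0// -x0.
- have [y0|y0] := ltP y 0.
    by rewrite -lerN2 -!fN fle ?lerN2// oppr_gt0.
  apply: (@le_trans _ _ 0); last exact: f0.
  by rewrite -oppr_ge0 -fN f0// oppr_ge0 ltW.
- exact: fle.
Qed.

(** The [phi] of the overview. The coefficient 1/400 is small enough for the eighth power to cost
    little in the moment bound of [transfer_le]. *)
Definition testpoly (R : realType) (x : R) : R :=
  x ^+ 6 - x ^+ 4 - x ^+ 8 / 400.

Lemma sum_signs_abspow_testpoly (R : realType) (p : R) : 3 < p ->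
  exists2 c : R, 0 < c &
  forall (y a b a' b' : R),
  0 <= a -> 0 <= b -> 0 <= a' -> 0 <= b' ->
  a ^+ 2 + b ^+ 2 = a' ^+ 2 + b' ^+ 2 -> a * b <= a' * b' ->
  c * (sum_signs (@testpoly R) y a' b' - sum_signs (@testpoly R) y a b) <=
  sum_signs (fun x : R => `|x| `^ p) y a' b' -
  sum_signs (fun x : R => `|x| `^ p) y a b.
Proof.
move=> p3; have [c0 c00 hc0] := powR_ge_poly (p - 4).
pose K := p * (p - 1) * (p - 2) * (p - 3).
have K0 : 0 < K by rewrite /K !mulr_gt0//; lra.
exists (K * c0); first exact: mulr_gt0.
set c := K * c0 => y a b a' b' a0 b0 a'0 b'0 e ab.
(* This is [|x|^p - c * testpoly x] as a sum of monomials, followed by its derivatives; [f4] is the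
   fourth one on the positive axis only, where [K * x^(p - 4)] comes from [|x|^p]. *)
pose f (x : R) := `|x| `^ p +
  (c * x ^+ 4 + (c / 400) * x ^+ 8 + (- c) * x ^+ 6).
pose f1 (x : R) := p * spow (p - 1) x +
  ((4 * c) * x ^+ 3 + (c / 50) * x ^+ 7 + (- 6 * c) * x ^+ 5).
pose f2 (x : R) := p * (p - 1) * `|x| `^ (p - 2) +
  ((12 * c) * x ^+ 2 + (7 * c / 50) * x ^+ 6 + (- 30 * c) * x ^+ 4).
pose f3 (x : R) := p * (p - 1) * (p - 2) * spow (p - 3) x +
  ((24 * c) * x ^+ 1 + (21 * c / 25) * x ^+ 5 + (- 120 * c) * x ^+ 3).
pose f4 (x : R) := K * x `^ (p - 4) +
  ((24 * c) * x ^+ 0 + (21 * c / 5) * x ^+ 4 + (- 360 * c) * x ^+ 2).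
have df (x : R) : is_derive x 1 f (f1 x).
  have p1 : 1 < p by lra.
  have := is_deriveD (is_derive_abspow x p1)
    (is_deriveD (is_deriveD (is_derive_monom c 4 x)
    (is_derive_monom (c / 400) 8 x)) (is_derive_monom (- c) 6 x)).
  move=> h; apply: is_derive_eq h _.
  by rewrite /f1 /=; field.
have df1 (x : R) : is_derive x 1 f1 (f2 x).
  have p1 : 1 < p - 1 by lra.
  have := is_deriveD (is_deriveZ p (is_derive_spow x p1))
    (is_deriveD (is_deriveD (is_derive_monom (4 * c) 3 x)
    (is_derive_monom (c / 50) 7 x)) (is_derive_monom (- 6 * c) 5 x)).
  move=> h; apply: is_derive_eq h _.
  by rewrite /f2 /GRing.scale /= (_ : p - 1 - 1 = p - 2); [field|ring].
have df2 (x : R) : is_derive x 1 f2 (f3 x).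
  have p1 : 1 < p - 2 by lra.
  have := is_deriveD (is_deriveZ (p * (p - 1)) (is_derive_abspow x p1))
    (is_deriveD (is_deriveD (is_derive_monom (12 * c) 2 x)
    (is_derive_monom (7 * c / 50) 6 x)) (is_derive_monom (- 30 * c) 4 x)).
  move=> h; apply: is_derive_eq h _.
  by rewrite /f3 /GRing.scale /= (_ : p - 2 - 1 = p - 3); [field|ring].
have f3_le (x z : R) : 0 < x -> x <= z -> f3 x <= f3 z.
  move=> x0 xz; apply: (@is_derive_ge0_le _ f3 f4 _ _ xz) => u /andP[xu _].
    have u0 : 0 < u by apply: lt_le_trans xu.
    have ds : is_derive u 1 (spow (p - 3)) ((p - 3) * u `^ (p - 3 - 1)).
      apply: (@near_eq_is_derive R R^o R^o (fun z : R => z `^ (p - 3))).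
        by near=> b1; rewrite spow_pos//; near: b1; exact: lt_nbhsr.
      exact: is_derive1_powR.
    have := is_deriveD (is_deriveZ (p * (p - 1) * (p - 2)) ds)
      (is_deriveD (is_deriveD (is_derive_monom (24 * c) 1 u)
      (is_derive_monom (21 * c / 25) 5 u)) (is_derive_monom (- 120 * c) 3 u)).
    move=> h; apply: is_derive_eq h _.
    by rewrite /f4 /K /GRing.scale /= (_ : p - 3 - 1 = p - 4); [field|ring].
  have u0 : 0 < u by apply: lt_le_trans xu.
  have := hc0 u u0; rewrite -(ler_pM2l K0) mulrA -/c /f4 expr0.
  lra.
have c_gt0 : 0 < c by exact: mulr_gt0.
(* Near 0 the polynomial part alone is nonnegative: [120 x^2 <= 120 / 9 < 24]. Beyond 1/3,
   nonnegativity follows from monotonicity. *)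
have f3_small (x : R) : 0 < x -> x <= 3^-1 -> 0 <= f3 x.
  move=> x0 x3; rewrite /f3 spow_pos// addr_ge0//.
    by rewrite !mulr_ge0 ?powR_ge0//; lra.
  rewrite (_ : _ + _ = c * x * (24 + 21 / 25 * x ^+ 4 - 120 * x ^+ 2));
    last by field.
  have := sqr_ge0 (x ^+ 2); rewrite -exprM => x4.
  by rewrite !mulr_ge0 ?(ltW c_gt0) ?(ltW x0)//; nra.
have f3N x : f3 (- x) = - f3 x by rewrite /f3 spowN; ring.
have f3_ge0 x : 0 <= x -> 0 <= f3 x.
  rewrite le_eqVlt => /predU1P[<-|x0].
    by rewrite /f3 spow0 !expr0n/= !mulr0 !addr0.
  have [x3|/ltW x3] := leP x 3^-1; first exact: f3_small.
  by apply: le_trans (f3_le 3^-1 x _ x3) => //; exact: f3_small.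
have := sum_signs_le df df1 df2 (odd_homo_le f3N f3_ge0 f3_le) y
  a0 b0 a'0 b'0 e ab.
rewrite /sum_signs /f /testpoly; lra.
Unshelve. all: by end_near. Qed.

(** * Averages over sign patterns and moments of signed sums *)

Lemma sum_cst (R : pzSemiRingType) (T : finType) (c : R) :
  \sum_(t : T) c = #|T|%:R * c.
Proof.
by rewrite mulr_natl -sumr_const; apply: eq_bigl => t; rewrite inE.
Qed.

Section signs.
Variables (R : realType) (I : finType).
Implicit Types (a : I -> R) (s : {ffun I -> bool}) (f : R -> R).

Definition flip (k : I) s : {ffun I -> bool} :=
  [ffun i => if i == k then ~~ s i else s i].

Lemma flipK k : involutive (flip k).
Proof.
by move=> s; apply/ffunP => i; rewrite !ffunE; case: eqP => // _; rewrite negbK.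
Qed.

Lemma sum_flip (V : nmodType) k (h : {ffun I -> bool} -> V) :
  \sum_s h (flip k s) = \sum_s h s.
Proof. by rewrite [RHS](reindex_inj (inv_inj (flipK k))). Qed.

(** Indexed by a sequence, to allow induction and the removal of two indices while [s] still ranges
    over all patterns on [I]. *)
Definition signed_sum (r : seq I) a s : R := \sum_(k <- r) (-1) ^+ s k * a k.

Lemma signed_sum_flip r a s k : k \notin r ->
  signed_sum r a (flip k s) = signed_sum r a s.
Proof.
move=> kr; apply: eq_big_seq => i ir; rewrite ffunE.
by case: eqP => // ik; rewrite -ik ir in kr.
Qed.

Lemma signed_sum_cons k r a s :
  signed_sum (k :: r) a s = (-1) ^+ s k * a k + signed_sum r a s.
Proof. exact: big_cons. Qed.

Lemma signed_sum_cons_flip k r a s : k \notin r ->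
  signed_sum (k :: r) a (flip k s) = - ((-1) ^+ s k * a k) + signed_sum r a s.
Proof.
by move=> kr; rewrite signed_sum_cons signed_sum_flip// ffunE eqxx signrN mulNr.
Qed.

(** Orthogonality of the signs: pairing [s] with [flip k s] cancels the cross terms. *)
Lemma sum_signed_sum_sqr r a : uniq r ->
  \sum_s signed_sum r a s ^+ 2 =
  #|{ffun I -> bool}|%:R * \sum_(k <- r) a k ^+ 2.
Proof.
elim: r => [_|k r ih /= /andP[kr ur]].
  by rewrite big_nil mulr0 big1// => s _; rewrite /signed_sum big_nil expr0n.
rewrite big_cons mulrDr -(ih ur).
suff : \sum_s signed_sum (k :: r) a s ^+ 2 +
    \sum_s signed_sum (k :: r) a (flip k s) ^+ 2 =
    \sum_(s : {ffun I -> bool}) 2 * a k ^+ 2 + \sum_s 2 * signed_sum r a s ^+ 2.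
  rewrite (sum_flip k (fun s => signed_sum (k :: r) a s ^+ 2)).
  by rewrite sum_cst -mulr_sumr; lra.
rewrite -!big_split; apply: eq_bigr => s _ /=.
rewrite signed_sum_cons_flip// signed_sum_cons.
by case: (s k) => /=; rewrite ?expr1 ?expr0; ring.
Qed.

(** The same pairing, with [(x + y)^4 + (x - y)^4 = 2 x^4 + 12 x^2 y^2 + 2 y^4]; the constant 3
    makes the mixed terms match and leaves a slack of [2 a_k^4] per pattern. *)
Lemma sum_signed_sum_pow4 r a : uniq r ->
  \sum_s signed_sum r a s ^+ 4 <=
  #|{ffun I -> bool}|%:R * (3 * (\sum_(k <- r) a k ^+ 2) ^+ 2).
Proof.
elim: r => [_|k r ih /= /andP[kr ur]].
  rewrite big_nil expr0n/= !mulr0 big1// => s _.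
  by rewrite /signed_sum big_nil expr0n.
have : \sum_s signed_sum (k :: r) a s ^+ 4 +
    \sum_s signed_sum (k :: r) a (flip k s) ^+ 4 =
    \sum_(s : {ffun I -> bool}) 2 * a k ^+ 4
    + \sum_s 12 * a k ^+ 2 * signed_sum r a s ^+ 2
    + \sum_s 2 * signed_sum r a s ^+ 4.
  rewrite -!big_split; apply: eq_bigr => s _ /=.
  rewrite signed_sum_cons_flip// signed_sum_cons.
  by case: (s k) => /=; rewrite ?expr1 ?expr0; ring.
rewrite (sum_flip k (fun s => signed_sum (k :: r) a s ^+ 4)).
rewrite sum_cst -!mulr_sumr sum_signed_sum_sqr// big_cons.
move: (ih ur); set N := (#|_|)%:R; set V := \sum_(_ <- r) _.
have : 0 <= N * a k ^+ 4 by rewrite mulr_ge0// -[4%N]/(2 * 2)%N exprM sqr_ge0.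
lra.
Qed.

Definition mean_signs f a : R :=
  (\sum_s f (signed_sum (index_enum I) a s)) / #|{ffun I -> bool}|%:R.

Lemma mean_signs_split f a (i j : I) : i != j ->
  4 * \sum_s f (signed_sum (index_enum I) a s) =
  \sum_s sum_signs f
    (signed_sum [seq k <- index_enum I | (k != i) && (k != j)] a s) (a i) (a j).
Proof.
move=> ij; set r := [seq _ <- _ | _].
pose h s := f (signed_sum (index_enum I) a s).
have hE s : h s = f (signed_sum r a s + (-1) ^+ s i * a i + (-1) ^+ s j * a j).
  rewrite /h /signed_sum (bigD1 i)//= (bigD1 j) 1?eq_sym//= big_filter.
  by congr f; ring.
have ir : i \notin r by rewrite mem_filter eqxx.
have jr : j \notin r by rewrite mem_filter eqxx andbF.
(* Each of the four sums equals the original one; together they run over the four signs at [i] and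
   [j] with the other signs fixed. *)
transitivity (\sum_s h s + \sum_s h (flip i s) + \sum_s h (flip j s)
    + \sum_s h (flip i (flip j s))).
  rewrite !(sum_flip i h) (sum_flip j h) (sum_flip j (fun s => h (flip i s))).
  by rewrite (sum_flip i h); ring.
rewrite -!big_split; apply: eq_bigr => s _ /=.
rewrite !hE !signed_sum_flip// !ffunE !eqxx (negbTE ij) [j == i]eq_sym.
rewrite (negbTE ij).
rewrite /sum_signs; move: (signed_sum r a s) => y.
by case: (s i); case: (s j) => /=; rewrite ?expr1 ?expr0 ?mul1r ?mulN1r;
  rewrite ?opprD ?opprK ?addrA; ring.
Qed.

End signs.

(** * The gain from one transfer *)

(** For fixed [q] and [y] the sum is a quadratic polynomial in [(a b)^2], so the difference has the
    factor [r' - r]. *)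
Lemma sum_signs_testpoly (R : realType) (y a b a' b' : R) :
  a ^+ 2 + b ^+ 2 = a' ^+ 2 + b' ^+ 2 ->
  let q := a ^+ 2 + b ^+ 2 in
  let r := (a * b) ^+ 2 in
  let r' := (a' * b') ^+ 2 in
  sum_signs (@testpoly R) y a' b' - sum_signs (@testpoly R) y a b =
  4 * (r' - r) * (60 * y ^+ 2 + 12 * q - 4 -
   (280 * y ^+ 4 + 336 * q * y ^+ 2 + 24 * q ^+ 2 + 16 * (r + r')) / 400).
Proof.
move=> e q r r'.
(* [Q r] is the mean of [testpoly] at [y] plus a symmetric random variable whose
   square is [q + 2 a b] or [q - 2 a b] with equal probabilities. *)
pose Q (r : R) : R :=
  (y ^+ 6 + 15 * y ^+ 4 * q + 15 * y ^+ 2 * (q ^+ 2 + 4 * r) + q ^+ 3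
   + 12 * q * r)
  - (y ^+ 4 + 6 * y ^+ 2 * q + q ^+ 2 + 4 * r)
  - (y ^+ 8 + 28 * y ^+ 6 * q + 70 * y ^+ 4 * (q ^+ 2 + 4 * r)
     + 28 * y ^+ 2 * (q ^+ 3 + 12 * q * r)
     + q ^+ 4 + 24 * q ^+ 2 * r + 16 * r ^+ 2) / 400.
have -> : sum_signs (@testpoly R) y a b = 4 * Q r.
  by rewrite /sum_signs /testpoly /Q /r /q; field.
have -> : sum_signs (@testpoly R) y a' b' = 4 * Q r'.
  by rewrite /sum_signs /testpoly /Q /r' /q e; field.
by rewrite /Q; field.
Qed.

Lemma transfer_le (R : realType) (I : finType) (f : R -> R) (c : R) :
  0 < c ->
  (forall (y a b a' b' : R),
    0 <= a -> 0 <= b -> 0 <= a' -> 0 <= b' ->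
    a ^+ 2 + b ^+ 2 = a' ^+ 2 + b' ^+ 2 -> a * b <= a' * b' ->
    c * (sum_signs (@testpoly R) y a' b' - sum_signs (@testpoly R) y a b) <=
    sum_signs f y a' b' - sum_signs f y a b) ->
  forall (a a' : I -> R) (i j : I), i != j ->
  (forall k, k != i -> k != j -> a' k = a k) ->
  (forall k, 0 <= a k) -> (forall k, 0 <= a' k) ->
  \sum_k a k ^+ 2 = 1 ->
  a i ^+ 2 + a j ^+ 2 = a' i ^+ 2 + a' j ^+ 2 ->
  a i * a j <= a' i * a' j ->
  mean_signs f a + 2 * c * (\sum_k a k ^+ 4 - \sum_k a' k ^+ 4)
    <= mean_signs f a'.
Proof.
move=> c0 hf a a' i j ij aE a0 a'0 a1 e ab.
set q := a i ^+ 2 + a j ^+ 2.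
pose r := (a i * a j) ^+ 2; pose r' := (a' i * a' j) ^+ 2.
have rr' : r <= r' by rewrite /r /r' ler_sqr ?nnegrE ?mulr_ge0.
have split_sum (b : I -> R) n : \sum_k b k ^+ n =
    b i ^+ n + b j ^+ n + \sum_(k | (k != i) && (k != j)) b k ^+ n.
  by rewrite (bigD1 i)//= (bigD1 j) 1?eq_sym//= addrA.
(* Only two terms change, and [a_i^4 + a_j^4 = q^2 - 2 r] with [q] preserved. *)
have -> : \sum_k a k ^+ 4 - \sum_k a' k ^+ 4 = 2 * (r' - r).
  rewrite !split_sum [X in _ - (_ + X)](_ : _ =
      \sum_(k | (k != i) && (k != j)) a k ^+ 4); last first.
    by apply: eq_bigr => k /andP[ki kj]; rewrite aE.
  have : q ^+ 2 = (a' i ^+ 2 + a' j ^+ 2) ^+ 2 by rewrite /q e.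
  rewrite /q /r /r'; lra.
pose l := [seq k <- index_enum I | (k != i) && (k != j)].
have ul : uniq l by rewrite filter_uniq// index_enum_uniq.
pose V := \sum_(k <- l) a k ^+ 2.
have VE : V = 1 - q by rewrite /V big_filter -a1 split_sum /q; ring.
have V0 : 0 <= V by apply: sumr_ge0 => k _; exact: sqr_ge0.
have q0 : 0 <= q by rewrite addr_ge0// sqr_ge0.
set N : R := #|{ffun I -> bool}|%:R.
have N0 : 0 < N by rewrite ltr0n; apply/card_gt0P; exists [ffun=> true].
rewrite /mean_signs -/N -(ler_pM2r N0) mulrDl !divfK ?gt_eqF//.
rewrite -(ler_pM2l (_ : 0 < 4 :> R))// mulrDr !(mean_signs_split _ _ ij).
rewrite -lerBrDl -sumrB.
have lE s : signed_sum l a' s = signed_sum l a s.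
  rewrite /signed_sum !big_filter; apply: eq_bigr => k /andP[ki kj].
  by rewrite aE.
apply: (@le_trans _ _ (\sum_s
    c * (sum_signs (@testpoly R) (signed_sum l a s) (a' i) (a' j) -
         sum_signs (@testpoly R) (signed_sum l a s) (a i) (a j)))); last first.
  by apply: ler_sum => s _; rewrite lE; exact: hf.
under eq_bigr do rewrite (sum_signs_testpoly _ e) -/q -/r -/r'.
rewrite -!mulr_sumr.
have -> : \sum_(s : {ffun I -> bool}) (60 * signed_sum l a s ^+ 2 + 12 * q - 4 -
    (280 * signed_sum l a s ^+ 4 + 336 * q * signed_sum l a s ^+ 2
     + 24 * q ^+ 2 + 16 * (r + r')) / 400) =
  60 * (N * V) + N * (12 * q - 4) - (280 * \sum_s signed_sum l a s ^+ 4
    + 336 * q * (N * V) + N * (24 * q ^+ 2 + 16 * (r + r'))) / 400.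
  rewrite -(sum_signed_sum_sqr a ul) -!sum_cst !mulr_sumr -!big_split/=.
  by rewrite mulr_suml -sumrB; apply: eq_bigr => s _; ring.
have := sum_signed_sum_pow4 a ul; rewrite -/N -/V.
set W := \sum_s _ => WV.
have q1 : q <= 1 by lra.
have V1 : V ^+ 2 <= 1 by rewrite expr_le1//; lra.
have r1 : r' <= 4^-1.
  have : 0 <= (a' i ^+ 2 - a' j ^+ 2) ^+ 2 by exact: sqr_ge0.
  have : q ^+ 2 = (a' i ^+ 2 + a' j ^+ 2) ^+ 2 by rewrite /q e.
  have : q ^+ 2 <= 1 by rewrite expr_le1.
  rewrite /r'; lra.
have qV : q * V <= 4^-1.
  by have := sqr_ge0 (q - V); rewrite VE; lra.
have W3 : W <= N * 3 by apply: le_trans WV _; rewrite ler_pM2l//; lra.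
have q2 : q ^+ 2 <= 1 by rewrite expr_le1.
set Z := (X in c * (_ * X)).
(* Per pattern, [60 V + 12 q - 4 = 56 - 48 q >= 8] as [V = 1 - q], while the subtracted part is at
   most [(840 + 84 + 24 + 8) / 400 < 3]. *)
have key : N * 4 <= Z.
  have : N * (q * V) <= N * 4^-1 by rewrite ler_pM2l.
  have : N * (r + r') <= N * 2^-1 by rewrite ler_pM2l//; lra.
  have : N * q ^+ 2 <= N * 1 by rewrite ler_pM2l.
  have : N * q <= N * 1 by rewrite ler_pM2l.
  rewrite /Z VE; lra.
have : c * (4 * (r' - r)) * (N * 4) <= c * (4 * (r' - r)) * Z.
  by rewrite ler_wpM2l// mulr_ge0 ?mulr_ge0 ?subr_ge0 ?(ltW c0).
lra.
Qed.

(** * Iterating transfers down to equal weights *)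

(** Induction on the number of squared weights different from their mean [u]; the gains telescope,
    and equal weights have sum of fourth powers [u]. *)
Lemma mean_signs_le_equal (R : realType) (I : finType) (f : R -> R) (c : R) :
  0 < c ->
  (forall (a a' : I -> R) (i j : I), i != j ->
    (forall k, k != i -> k != j -> a' k = a k) ->
    (forall k, 0 <= a k) -> (forall k, 0 <= a' k) ->
    \sum_k a k ^+ 2 = 1 ->
    a i ^+ 2 + a j ^+ 2 = a' i ^+ 2 + a' j ^+ 2 ->
    a i * a j <= a' i * a' j ->
    mean_signs f a + c * (\sum_k a k ^+ 4 - \sum_k a' k ^+ 4)
      <= mean_signs f a') ->
  forall a : I -> R, (forall k, 0 <= a k) -> \sum_k a k ^+ 2 = 1 ->
  mean_signs f a + c * (\sum_k a k ^+ 4 - #|I|%:R^-1)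
    <= mean_signs f (fun _ : I => Num.sqrt #|I|%:R^-1).
Proof.
move=> c0 transfer a; set u : R := #|I|%:R^-1.
have [m] := ubnP #|[pred k | a k ^+ 2 != u]|.
elim: m a => // m ih a am a0 a1.
have u0 : 0 <= u by rewrite invr_ge0 ler0n.
have I0 : (0 < #|I|)%N.
  rewrite lt0n; apply/eqP => I0; have := oner_neq0 R.
  by rewrite -a1 big_pred0 ?eqxx// => k; have := card0_eq I0 k.
have uI : \sum_(k : I) u = 1 by rewrite sum_cst mulfV// pnatr_eq0 -lt0n.
have d0 : \sum_k (a k ^+ 2 - u) = 0 by rewrite sumrB a1 uI subrr.
have [/forallP alleq|] := boolP [forall k, a k ^+ 2 == u].
  have au k : a k ^+ 2 = u by exact/eqP.
  have -> : a = (fun=> Num.sqrt u).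
    by apply/funext => k; rewrite -(au k) sqrtr_sqr ger0_norm.
  rewrite (_ : \sum_k _ = u); first by rewrite subrr mulr0 addr0.
  under eq_bigr do rewrite (exprM _ 2 2) sqr_sqrtr//.
  by rewrite sum_cst expr2 mulrA mulfV ?mul1r// pnatr_eq0 -lt0n.
rewrite negb_forall => /existsP[k0 k0u].
have [i ui] : exists i, u < a i ^+ 2.
  apply/existsP; apply: contraNT k0u => /existsPn h.
  have s0 : \sum_k (u - a k ^+ 2) = 0.
    transitivity (- \sum_k (a k ^+ 2 - u)); last by rewrite d0 oppr0.
    by rewrite -sumrN; apply: eq_bigr => k _; rewrite opprB.
  have nneg k : 0 <= u - a k ^+ 2 by rewrite subr_ge0 leNgt h.
  by rewrite eq_sym -subr_eq0 (psumr_eq0P (fun k _ => nneg k) s0).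
have [j uj] : exists j, a j ^+ 2 < u.
  apply/existsP; apply: contraNT k0u => /existsPn h.
  have nneg k : 0 <= a k ^+ 2 - u by rewrite subr_ge0 leNgt h.
  by rewrite -subr_eq0 (psumr_eq0P (fun k _ => nneg k) d0).
have ij : i != j by apply: contraTN ui => /eqP ->; rewrite -leNgt ltW.
(* The largest amount that overshoots [u] at neither index; one of the two squared weights lands
   exactly on [u]. *)
pose d := Num.min (a i ^+ 2 - u) (u - a j ^+ 2).
have d1 : d <= a i ^+ 2 - u by rewrite ge_min lexx.
have d2 : d <= u - a j ^+ 2 by rewrite ge_min lexx orbT.
have d_ge0 : 0 <= d by rewrite le_min !subr_ge0 !ltW.
pose a' k := if k == i then Num.sqrt (a i ^+ 2 - d)
  else if k == j then Num.sqrt (a j ^+ 2 + d) else a k.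
have a'i : a' i = Num.sqrt (a i ^+ 2 - d) by rewrite /a' eqxx.
have a'j : a' j = Num.sqrt (a j ^+ 2 + d).
  by rewrite /a' eq_sym (negbTE ij) eqxx.
have a'i2 : a' i ^+ 2 = a i ^+ 2 - d by rewrite a'i sqr_sqrtr//; lra.
have a'j2 : a' j ^+ 2 = a j ^+ 2 + d.
  by rewrite a'j sqr_sqrtr// addr_ge0// sqr_ge0.
have a'E k : k != i -> k != j -> a' k = a k.
  by rewrite /a' => /negbTE -> /negbTE ->.
have a'0 k : 0 <= a' k.
  rewrite /a'; case: ifP => _; first exact: sqrtr_ge0.
  by case: ifP => _ //; exact: sqrtr_ge0.
have e : a i ^+ 2 + a j ^+ 2 = a' i ^+ 2 + a' j ^+ 2 by rewrite a'i2 a'j2; ring.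
(* The squared product grows by [d (a_i^2 - a_j^2 - d)], and [a_i^2 - a_j^2 >= 2 d]. *)
have ab : a i * a j <= a' i * a' j.
  rewrite -ler_sqr ?nnegrE ?mulr_ge0// !exprMn a'i2 a'j2.
  have : 0 <= d * (a i ^+ 2 - a j ^+ 2 - d) by rewrite mulr_ge0//; lra.
  lra.
have a'1 : \sum_k a' k ^+ 2 = 1.
  rewrite -a1 (bigD1 i)//= [RHS](bigD1 i)//= (bigD1 j) 1?eq_sym//=.
  rewrite [in RHS](bigD1 j) 1?eq_sym//= !addrA -e; congr (_ + _).
  by apply: eq_bigr => k /andP[ki kj]; rewrite a'E.
apply: le_trans (ih a' _ a'0 a'1); last first.
  rewrite -ltnS; apply: leq_trans am; rewrite ltnS; apply: proper_card.
  have ui' : a i ^+ 2 != u by rewrite gt_eqF.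
  have uj' : a j ^+ 2 != u by rewrite lt_eqF.
  apply/properP; split.
    apply/fintype.subsetP => k; rewrite !inE.
    have [->//|ki] := eqVneq k i; have [->//|kj] := eqVneq k j.
    by rewrite a'E.
  have [dE|dE] : d = a i ^+ 2 - u \/ d = u - a j ^+ 2.
    by rewrite /d minEle; case: ifP => _; [left|right].
  - by exists i; rewrite !inE// a'i2 dE negbK; apply/eqP; ring.
  - by exists j; rewrite !inE// a'j2 dE negbK; apply/eqP; ring.
have := transfer a a' i j ij a'E a0 a'0 a1 e ab.
lra.
Qed.

(** * From the probability space to a finite average *)

(** By independence each sign pattern has probability [1 / N]; these disjoint events have total mass
    1, so the integrand is almost surely a finite combination of their indicators. *)
Lemma expectation_signs (R : realType) (d : measure_display)
    (T : measurableType d) (P : probability T R) (I : finType)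
    (eps : I -> {RV P >-> R}) (f : R -> R) (a : I -> R) :
  (forall i, rademacher (eps i)) -> mutually_independent eps ->
  (forall x, 0 <= f x) -> measurable_fun setT f ->
  ('E_P[fun w => f (\sum_i a i * eps i w)%R] = (mean_signs f a)%:E)%E.
Proof.
move=> rad ind f0 mf; rewrite unlock.
pose E (s : {ffun I -> bool}) : set T :=
  \bigcap_(i in [set` [set: I]%SET]) (eps i @^-1` [set (-1) ^+ s i]).
have EP s w : E s w <-> forall i, eps i w = (-1) ^+ s i.
  split => [h i|h i _]; last exact: h.
  by apply: (h i); rewrite /= inE.
have mB (s : {ffun I -> bool}) i : measurable [set (-1 : R) ^+ s i] by [].
have mE s : measurable (E s).
  apply: fin_bigcap_measurable; first exact: finite_finset.
  by move=> i _; rewrite -[X in measurable X]setTI; exact: measurable_funP.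
pose N : R := #|{ffun I -> bool}|%:R.
have N0 : N != 0.
  by rewrite pnatr_eq0 -lt0n; apply/card_gt0P; exists [ffun=> true].
have PE s : P (E s) = (N^-1)%:E.
  rewrite /E ind// (eq_bigr (fun=> (2^-1)%:E)).
    rewrite prodEFin prodr_const /N card_ffun card_bool natrX exprVn.
    by rewrite cardsT.
  by move=> i _; have [h1 h2] := rad i; case: (s i); rewrite ?expr1 ?expr0.
have Einj s s' w : E s w -> E s' w -> s = s'.
  move=> /EP h /EP h'; apply/ffunP => i; have := h i; rewrite h'.
  by case: (s i); case: (s' i) => //=; rewrite ?expr1 ?expr0; lra.
have tE : trivIset setT E.
  by move=> s s' _ _ [w [Es Es']]; exact: Einj Es Es'.
(* The variables may take values other than 1 and -1 on a null set, so [U] need not be the whole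
   space. *)
pose U := \bigcup_(s in [set` index_enum {ffun I -> bool}]) E s.
have mU : measurable U.
  by apply: fin_bigcup_measurable.
have PU : P U = 1%E.
  rewrite /U measure_fin_bigcup//; last exact: sub_trivIset tE.
  rewrite -fsbig_seq ?index_enum_uniq// (eq_bigr (fun=> (N^-1)%:E)); last first.
    by move=> s _; exact: PE.
  by rewrite sumEFin sum_cst mulfV.
have PUc : P (~` U) = 0%E.
  by rewrite probability_setC// PU subee.
have mS : measurable_fun setT (fun w => f (\sum_i a i * eps i w)).
  apply: (measurableT_comp mf); apply: measurable_sum => i.
  by apply: measurable_funM => //; exact: measurable_funP.
transitivity (\int[P]_w (\sum_(s : {ffun I -> bool})
    (f (signed_sum (index_enum I) a s) * \1_(E s) w)%:E))%E.
  apply: ge0_ae_eq_integral => //.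
  - exact/measurable_EFinP.
  - apply: emeasurable_sum => s; apply/measurable_EFinP.
    by apply: measurable_funM => //; exact: measurable_indic.
  - by move=> w _; rewrite lee_fin.
  - by move=> w _; apply: sume_ge0 => s _; rewrite lee_fin mulr_ge0.
  exists (~` U); split => //; first exact: measurableC.
  move=> w /= h Uw; apply: h => _; case: Uw => s _ Es.
  rewrite (bigD1 s)//= [X in (_ + X)%E]big1 ?adde0.
    rewrite indicE mem_set// mulr1 /signed_sum; congr (EFin (f _)).
    by apply: eq_bigr => i _; rewrite (proj1 (EP s w) Es) mulrC.
  move=> s' s's; rewrite indicE memNset ?mulr0// => Es'.
  by move: s's; rewrite (Einj _ _ _ Es' Es) eqxx.
rewrite ge0_integral_sum//; last 2 first.
- move=> s; apply/measurable_EFinP.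
  by apply: measurable_funM => //; exact: measurable_indic.
- by move=> s w _; rewrite lee_fin mulr_ge0.
rewrite /mean_signs -/N mulr_suml -sumEFin; apply: eq_bigr => s _.
under eq_integral do rewrite EFinM.
rewrite ge0_integralZl_EFin//; last first.
  by apply/measurable_EFinP; exact: measurable_indic.
by rewrite integral_indic// setIT EFinM; congr (_ * _)%E; exact: PE.
Qed.

Theorem theorem2 (R : realType) (p : R) (hp : 3 < p) :
  exists2 C : R, 0 < C &
    forall (n : nat) (a : 'I_n -> R),
      (1 <= n)%N ->
      (forall i j : 'I_n, (i <= j)%N -> a j <= a i) ->
      (forall i : 'I_n, 0 <= a i) ->
      \sum_(i < n) a i ^+ 2 = 1 ->
    forall (d : measure_display) (T : measurableType d) (P : probability T R)
           (eps : 'I_n -> {RV P >-> R}),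
      (forall i : 'I_n, rademacher (eps i)) ->
      mutually_independent eps ->
    let S : T -> R := fun w => \sum_(i < n) a i * eps i w in
    let Sn : T -> R := fun w => (Num.sqrt n%:R)^-1 * \sum_(i < n) eps i w in
    ('E_P[fun w => (`|S w| `^ p)%R]
      <= 'E_P[fun w => (`|Sn w| `^ p)%R]
         - (C * \sum_(i < n) (a i ^+ 2 - n%:R^-1) ^+ 2)%:E)%E.
Proof.
have [c c0 hc] := sum_signs_abspow_testpoly hp.
(* The factor 2 is the one gained in [transfer_le]. *)
exists (2 * c); first by rewrite mulr_gt0.
move=> n a n1 _ a0 a1 d T P eps rad ind; cbv zeta.
have n0 : n%:R != 0 :> R by rewrite pnatr_eq0 -lt0n.
pose f (x : R) := `|x| `^ p.
have f0 x : 0 <= f x by exact: powR_ge0.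
have mf : measurable_fun setT f.
  apply: (measurableT_comp (f := fun x : R => x `^ p)).
    exact: measurable_powR.
  exact: normr_measurable.
have c20 : 0 < 2 * c by rewrite mulr_gt0.
have := mean_signs_le_equal c20 (transfer_le c0 hc) a0 a1.
rewrite card_ord => h.
(* Rewrites [Sn] as the weighted sum with all weights [sqrt (1/n)], so that [expectation_signs]
   covers both sides. *)
under [X in (_ <= 'E_P[X] - _)%E]eq_fun do rewrite mulr_sumr -sqrtrV ?ler0n//.
rewrite (expectation_signs a rad ind f0 mf).
rewrite (expectation_signs (fun=> Num.sqrt n%:R^-1) rad ind f0 mf).
rewrite -EFinB lee_fin lerBrDr.
have -> : \sum_(i < n) (a i ^+ 2 - n%:R^-1) ^+ 2 = \sum_i a i ^+ 4 - n%:R^-1.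
  transitivity (\sum_i (a i ^+ 4 - 2 * n%:R^-1 * a i ^+ 2 + n%:R^-1 ^+ 2)).
    by apply: eq_bigr => i _; ring.
  by rewrite big_split/= sumrB -mulr_sumr a1 sum_cst card_ord; field.
exact: h.
Qed.
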